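(* Let $W$ be a $\mathcal{T}$-module such that the restriction of $W$ to $\mathcal{U}(\mathfrak{t})$, where $\mathfrak{t}=\mathbb{C}L_0$, is free of rank $2$. Then there exist $\lambda\in\mathbb{C}^*$ and $\alpha\in\mathbb{C}$ such that $W$ or $\Pi(W)$ is isomorphic to $\mathcal{N}_1(\lambda,\alpha)$ or to $\mathcal{N}_{-1}(\lambda,\alpha)$.
   Context: The twisted $N=2$ superconformal algebra $\mathcal{T}$ is the Lie superalgebra over $\mathbb{C}$ with basis $\{L_m, I_r, G_p\mid m\in\mathbb{Z}, r\in\frac12+\mathbb{Z}, p\in\frac12\mathbb{Z}\}$, even part spanned by the $L_m,I_r$, odd part by the $G_p$, only nonzero brackets $[L_m,L_n]=(m-n)L_{m+n}$, $[L_m,I_r]=-rI_{m+r}$, $[L_m,G_p]=(\frac m2-p)G_{m+p}$, $[I_r,G_p]=G_{r+p}$, $[G_p,G_q]=(-1)^{2p}2L_{p+q}$ if $p+q\in\mathbb{Z}$, $[G_p,G_q]=(-1)^{2p+1}(p-q)I_{p+q}$ if $p+q\in\frac12+\mathbb{Z}$. Modules are $\mathbb{Z}_2$-graded; $\Pi$ is the parity-change functor. For $p\in\frac12\mathbb{Z}$, $\lambda^p$ means $(\lambda^{1/2})^{2p}$ for a fixed square root. For $\lambda\in\mathbb{C}^*,\alpha\in\mathbb{C},t=\pm1$, $\mathcal{N}_t(\lambda,\alpha)$ is the space $\mathbb{C}[x]\mathbf{1}_{\bar0}\oplus\mathbb{C}[y]\mathbf{1}_{\bar1}$ (even part $\mathbb{C}[x]\mathbf{1}_{\bar0}$,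 odd part $\mathbb{C}[y]\mathbf{1}_{\bar1}$; write $f(x)$ for $f(x)\mathbf{1}_{\bar0}$, $g(y)$ for $g(y)\mathbf{1}_{\bar1}$) with $L_mf(x)=\lambda^m(x+m\alpha)f(x+m)$, $L_mg(y)=\lambda^m(y+m(\alpha+\frac12))g(y+m)$, $I_rf(x)=-2t^{2r}\lambda^r\alpha f(x+r)$, $I_rg(y)=t^{2r}\lambda^r(1-2\alpha)g(y+r)$, $G_pf(x)=t^{2p}\lambda^pf(y+p)$, $G_pg(y)=(-t)^{2p}\lambda^p(x+2p\alpha)g(x+p)$, for $m\in\mathbb{Z}$, $r\in\frac12+\mathbb{Z}$, $p\in\frac12\mathbb{Z}$. *)

(* Defs.v *)
From HB Require Import structures.
From Stdlib Require Import Reals.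
From mathcomp Require Import all_boot all_order all_algebra.
From mathcomp Require Import complex.
From mathcomp Require Import Rstruct.
Import GRing.Theory Num.Theory.
Set Implicit Arguments. Unset Strict Implicit. Unset Printing Implicit Defensive.
Local Open Scope ring_scope.

Definition CC : fieldType := complex R.

(* Indexing conventions for the basis of the twisted N=2 algebra T:
   - L_m, m in Z              : index m : int
   - I_r, r in 1/2 + Z        : index k : int, with r = k + 1/2
   - G_p, p in (1/2) Z        : index n : int, with p = n / 2            *)

(* A Z_2-graded T-module W = W0 (+) W1 is given by its even part V0, odd part V1
   and the components of the action of the basis elements:
   L0 m : V0 -> V0, L1 m : V1 -> V1, I0 k : V0 -> V0, I1 k : V1 -> V1,
   G0 n : V0 -> V1, G1 n : V1 -> V0. *)

Definition lin (U V : lmodType CC) (f : U -> V) : Prop :=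
  forall (a : CC) (u v : U), f (a *: u + v) = a *: f u + f v.

Section TModule.
Variables (V0 V1 : lmodType CC).
Variables (L0 I0 : int -> V0 -> V0) (L1 I1 : int -> V1 -> V1)
          (G0 : int -> V0 -> V1) (G1 : int -> V1 -> V0).

Definition opL (m : int) (w : V0 * V1) : V0 * V1 := (L0 m w.1, L1 m w.2).
Definition opI (k : int) (w : V0 * V1) : V0 * V1 := (I0 k w.1, I1 k w.2).
Definition opG (n : int) (w : V0 * V1) : V0 * V1 := (G1 n w.2, G0 n w.1).

Definition is_Tmodule : Prop :=
  (forall m, lin (L0 m)) /\ (forall m, lin (L1 m)) /\
  (forall k, lin (I0 k)) /\ (forall k, lin (I1 k)) /\
  (forall n, lin (G0 n)) /\ (forall n, lin (G1 n)) /\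
  (forall (m n : int) w,
      opL m (opL n w) - opL n (opL m w) = (m - n)%:~R *: opL (m + n) w) /\
  (* [L_m, I_r] = - r I_{m+r},  r = k + 1/2 *)
  (forall (m k : int) w,
      opL m (opI k w) - opI k (opL m w) = - (k%:~R + 1 / 2) *: opI (m + k) w) /\
  (* [L_m, G_p] = (m/2 - p) G_{m+p},  p = n/2 *)
  (forall (m n : int) w,
      opL m (opG n w) - opG n (opL m w) = ((m%:~R - n%:~R) / 2) *: opG (2 * m + n) w) /\
  (forall (k l : int) w, opI k (opI l w) - opI l (opI k w) = 0) /\
  (* [I_r, G_p] = G_{r+p} *)
  (forall (k n : int) w, opI k (opG n w) - opG n (opI k w) = opG (2 * k + 1 + n) w) /\
  (* [G_p, G_q] = (-1)^{2p} 2 L_{p+q}  if p + q in Z *)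
  (forall (n n' m : int) w, n + n' = 2 * m ->
      opG n (opG n' w) + opG n' (opG n w) = ((-1) ^ n * 2) *: opL m w) /\
  (* [G_p, G_q] = (-1)^{2p+1} (p - q) I_{p+q}  if p + q in 1/2 + Z *)
  (forall (n n' k : int) w, n + n' = 2 * k + 1 ->
      opG n (opG n' w) + opG n' (opG n w)
        = ((-1) ^ (n + 1) * ((n%:~R - n'%:~R) / 2)) *: opI k w).

(* action of a polynomial in L_0, i.e. of U(C L_0) = C[L_0], on W *)
Definition L0poly (p : {poly CC}) (w : V0 * V1) : V0 * V1 :=
  \sum_(i < size p) p`_i *: iter i (opL 0) w.

Definition L0free_rank2 : Prop :=
  exists w1 w2 : V0 * V1,
    (forall w, exists p1 p2, w = L0poly p1 w1 + L0poly p2 w2) /\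
    (forall p1 p2, L0poly p1 w1 + L0poly p2 w2 = 0 -> p1 = 0 /\ p2 = 0).
End TModule.

Definition Tiso (V0 V1 U0 U1 : lmodType CC)
    (L0 I0 : int -> V0 -> V0) (L1 I1 : int -> V1 -> V1)
    (G0 : int -> V0 -> V1) (G1 : int -> V1 -> V0)
    (L0' I0' : int -> U0 -> U0) (L1' I1' : int -> U1 -> U1)
    (G0' : int -> U0 -> U1) (G1' : int -> U1 -> U0) : Prop :=
  exists (f0 : V0 -> U0) (f1 : V1 -> U1),
    lin f0 /\ lin f1 /\ bijective f0 /\ bijective f1 /\
    (forall m v, f0 (L0 m v) = L0' m (f0 v)) /\
    (forall m v, f1 (L1 m v) = L1' m (f1 v)) /\
    (forall k v, f0 (I0 k v) = I0' k (f0 v)) /\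
    (forall k v, f1 (I1 k v) = I1' k (f1 v)) /\
    (forall n v, f1 (G0 n v) = G0' n (f0 v)) /\
    (forall n v, f0 (G1 n v) = G1' n (f1 v)).

(* The module N_t(lambda, alpha), with mu a fixed square root of lambda,
   lambda = mu^2, so lambda^p = mu^(2p).  Even part C[x], odd part C[y], both
   represented by {poly CC}.  Shifts f(x+a) are f \Po ('X + a%:P). *)
Section Nmodule.
Variables (t mu alpha : CC).
Definition shift (a : CC) (f : {poly CC}) : {poly CC} := f \Po ('X + a%:P).

Definition NL0 (m : int) (f : {poly CC}) : {poly CC} :=
  mu ^ (2 * m) *: (('X + (m%:~R * alpha)%:P) * shift m%:~R f).
Definition NL1 (m : int) (g : {poly CC}) : {poly CC} :=
  mu ^ (2 * m) *: (('X + (m%:~R * (alpha + 1 / 2))%:P) * shift m%:~R g).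
(* I_r f(x) = -2 t^{2r} lambda^r alpha f(x+r),  r = k + 1/2 *)
Definition NI0 (k : int) (f : {poly CC}) : {poly CC} :=
  (- 2 * t ^ (2 * k + 1) * mu ^ (2 * k + 1) * alpha) *: shift (k%:~R + 1 / 2) f.
(* I_r g(y) = t^{2r} lambda^r (1 - 2 alpha) g(y+r) *)
Definition NI1 (k : int) (g : {poly CC}) : {poly CC} :=
  (t ^ (2 * k + 1) * mu ^ (2 * k + 1) * (1 - 2 * alpha)) *: shift (k%:~R + 1 / 2) g.
(* G_p f(x) = t^{2p} lambda^p f(y+p),  p = n/2 *)
Definition NG0 (n : int) (f : {poly CC}) : {poly CC} :=
  (t ^ n * mu ^ n) *: shift (n%:~R / 2) f.
(* G_p g(y) = (-t)^{2p} lambda^p (x + 2p alpha) g(x+p) *)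
Definition NG1 (n : int) (g : {poly CC}) : {poly CC} :=
  ((- t) ^ n * mu ^ n) *: (('X + (n%:~R * alpha)%:P) * shift (n%:~R / 2) g).
End Nmodule.

Definition iso_to_N (V0 V1 : lmodType CC)
    (L0 I0 : int -> V0 -> V0) (L1 I1 : int -> V1 -> V1)
    (G0 : int -> V0 -> V1) (G1 : int -> V1 -> V0) (t mu alpha : CC) : Prop :=
  @Tiso V0 V1 {poly CC} {poly CC} L0 I0 L1 I1 G0 G1
    (NL0 mu alpha) (NI0 t mu alpha) (NL1 mu alpha) (NI1 t mu alpha)
    (NG0 t mu) (NG1 t mu alpha).

(* Pi(W): parity change -- even part V1, odd part V0, same action. *)
Definition Pi_iso_to_N (V0 V1 : lmodType CC)
    (L0 I0 : int -> V0 -> V0) (L1 I1 : int -> V1 -> V1)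
    (G0 : int -> V0 -> V1) (G1 : int -> V1 -> V0) (t mu alpha : CC) : Prop :=
  @iso_to_N V1 V0 L1 I1 L0 I0 G1 G0 t mu alpha.

(* Main.v *)
Require Import Defs.
From HB Require Import structures.
From Stdlib Require Import Reals ClassicalEpsilon.
From mathcomp Require Import all_boot all_order all_algebra.
From mathcomp Require Import complex.
From mathcomp Require Import Rstruct.
From mathcomp Require Import ring zify.
Import GRing.Theory Num.Theory.
Set Implicit Arguments. Unset Strict Implicit. Unset Printing Implicit Defensive.
Local Open Scope ring_scope.

(** Since G_0^2 = L_0 acts injectively, both parities are nonzero; as W has rank 2
    over C[L_0], each is then torsion-free of rank 1, hence C[L_0] e_i. Comparing
    G_0 e_0 = p e_1 and G_0 e_1 = q e_0 gives p q = x, so up to parity change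
    G_0 1_0 = 1_1. The commutators with L_0 make every other generator a translation
    followed by multiplication by a polynomial. For half-integers r, the relation for
    [G_r, G_-r] and [I_r, I_-r] = 0 say that certain polynomials are periodic, hence
    constant; this forces G_r 1_0 and I_r 1_0 to be scalars. Then [I_r, G_q] = G_{r+q}
    shows that G_{n/2} 1_0 = mu^n and determines everything from mu and I_{1/2} 1_0.
    The sign t is absorbed in the choice of the square root mu. *)

(* [lia] does not recognise the size of a polynomial as an atom. *)
Ltac size_lia :=
  repeat match goal with H : context [size (polyseq ?p)] |- _ => revert H end;
  repeat match goal with |- context [size (polyseq ?p)] =>
    let n := fresh in move: (size (polyseq p)) => n end;
  lia.

(** * Translations of polynomials and degree bounds from periodicity *)

Section Translations.
Variable F : fieldType.
Hypothesis charF : forall n : nat, (n%:R == 0 :> F) = (n == 0%N).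
Local Notation "p ^[ a ]" := (p \Po ('X + a%:P)) (at level 2, format "p ^[ a ]").

Lemma translate0 (p : {poly F}) : p^[0] = p.
Proof. by rewrite addr0 comp_polyXr. Qed.

Lemma translateD (p : {poly F}) a b : p^[a]^[b] = p^[a + b].
Proof. by rewrite -comp_polyA comp_polyD comp_polyX comp_polyC polyCD -addrA [b%:P + _]addrC. Qed.

Lemma size_translate (p : {poly F}) a : size p^[a] = size p.
Proof. by rewrite size_comp_poly2 // size_XaddC. Qed.

Lemma translate_eq0 (p : {poly F}) a : (p^[a] == 0) = (p == 0).
Proof. by rewrite -!size_poly_eq0 size_translate. Qed.

(** Periodicity makes p - p(0) vanish at every multiple of [a]. These multiples are pairwise
    distinct in characteristic zero, so there are more roots than the degree allows. *)
Lemma size_periodic (p : {poly F}) a : a != 0 -> p^[a] = p -> (size p <= 1)%N.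
Proof.
move=> a0 pa; set q := p - p.[0]%:P.
have pna n : p.[a *+ n] = p.[0].
  elim: n => [|n <-]; first by rewrite mulr0n.
  by rewrite -[in RHS]pa horner_comp !hornerE mulrSr.
have q0 : q = 0.
  apply/eqP/negPn/negP => q0.
  have := @max_poly_roots _ q [seq a *+ i | i <- iota 0 (size q)] q0.
  rewrite size_map size_iota ltnn => H; apply/notF/H => //.
    by apply/allP => _ /mapP [n _ ->]; rewrite /root /q !hornerE pna subrr.
  rewrite map_inj_uniq ?iota_uniq // => m n.
  wlog mn : m n / (m <= n)%N.
    by move=> W; case: (leqP m n) => [/W//|/ltnW/W{}W /esym/W].
  move=> /eqP; rewrite eq_sym -subr_eq0 -mulrnBr // -mulr_natr mulf_eq0 (negPf a0) /= charF.
  by rewrite subn_eq0 => nm; apply/eqP; rewrite eqn_leq mn.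
have -> : p = p.[0]%:P by apply/eqP; rewrite -subr_eq0 -/q q0.
exact: size_polyC_leq1.
Qed.

(** The hypothesis says exactly that [p^[- a] * q] is [a]-periodic, hence constant; degrees add, so
    a nonzero product forces both factors to be constant. The relation comes from the vanishing of
    [I_r, I_{-r}]. *)
Lemma invariant_pair_const (a : F) (p q : {poly F}) : a != 0 ->
  q^[a] * p = p^[- a] * q -> p != 0 -> q != 0 -> (size p <= 1)%N.
Proof.
move=> a0 pq p0 q0.
have/size_periodic : (p^[- a] * q)^[a] = p^[- a] * q.
  by rewrite comp_polyM translateD addNr translate0 -pq mulrC.
move=> /(_ a0); rewrite size_mul ?translate_eq0 // size_translate.
move: p0 q0; rewrite -!size_poly_gt0; size_lia.
Qed.

(* With A(x) = u'(x+a) v(x), eliminating the other product from the two relations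
   gives A(x+a) - A(x-a) = -2a, so A + x is 2a-periodic, hence constant. *)
Lemma opposite_product (a : F) (u u' v v' : {poly F}) : a != 0 ->
  u'^[a] * v + u^[- a] * v' = -2 *: 'X ->
  v'^[a] * u + v^[- a] * u' = -2 *: 'X ->
  [/\ u' != 0, v != 0 & (size u' + size v = 3)%N].
Proof.
move=> a0 E0 E1; set A := u'^[a] * v in E0.
have EB : u^[- a] * v' = -2 *: 'X - A by rewrite -E0 addrAC subrr add0r.
have E2 : A^[- a] = A^[a] + (2 * a)%:P.
  have BA : (u^[- a] * v')^[a] = v'^[a] * u.
    by rewrite comp_polyM translateD addNr translate0 mulrC.
  have AA : A^[- a] = v^[- a] * u'.
    by rewrite comp_polyM translateD subrr translate0 mulrC.
  move: E1; rewrite -BA -AA EB comp_polyB comp_polyZ comp_polyX => /(canRL (addKr _)) ->.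
  by rewrite scalerDr -!mul_polyC polyCM !polyCN; ring.
have PE : (A + 'X)^[a] = (A + 'X)^[- a].
  by rewrite !comp_polyD E2 !comp_polyX polyCM polyCN; ring.
have/size_periodic : (A + 'X)^[2 * a] = A + 'X.
  by rewrite mulr_natl mulr2n -translateD PE translateD addNr translate0.
rewrite mulf_neq0 ?charF // => /(_ isT) sP.
have sA : size A = 2.
  have -> : A = - 'X + (A + 'X) by ring.
  by rewrite size_polyDl ?size_polyN ?size_polyX.
have: A != 0 by rewrite -size_poly_gt0 sA.
rewrite mulf_eq0 translate_eq0 negb_or => /andP [u0 v0]; split=> //.
move: sA; rewrite size_mul ?translate_eq0 // size_translate.
by move: u0 v0; rewrite -!size_poly_gt0; size_lia.
Qed.

(** Here [a] is the half-integer r; unprimed polynomials have index r and primed ones index -r. The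
    products of opposite G's bound the degrees of [u] and [v], and the vanishing of [I_r, I_{-r}] on
    each parity excludes the remaining nonconstant cases. *)
Lemma half_integer_const (a : F) (u u' v v' c c' d d' : {poly F}) : a != 0 ->
  u'^[a] * v + u^[- a] * v' = -2 *: 'X ->
  v'^[a] * u + v^[- a] * u' = -2 *: 'X ->
  'X * u + v = a *: c -> 'X * u' + v' = - a *: c' ->
  c'^[a] * c = c^[- a] * c' -> d'^[a] * d = d^[- a] * d' ->
  d = c + u -> d' = c' + u' ->
  (size u == 1%N) && (size c <= 1)%N.
Proof.
move=> a0 E0 E1 Ec Ec' Cc Cd dE d'E.
have Na0 : - a != 0 by rewrite oppr_eq0.
have [u'0 v0 suv'] := opposite_product a0 E0 E1.
(* Exchanging r and -r gives the second count: deg u + deg v' = 1. *)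
have [|//|u0 v'0 suv] := @opposite_product (- a) u' u v' v Na0.
- by rewrite opprK addrC.
- by rewrite opprK addrC.
(* A nonconstant [c] cannot be paired with a nonzero [c'], so [c'] vanishes and [Ec'] gives [v']. *)
have c'0 : (1 < size c)%N -> v' = - ('X * u').
  move=> sc; move: Ec'.
  have [->|c'N0] := eqVneq c' 0.
    by rewrite scaler0 => /eqP; rewrite addr_eq0 => /eqP ->; rewrite opprK.
  have cN0 : c != 0 by rewrite -size_poly_gt0; size_lia.
  by have := invariant_pair_const a0 Cc cN0 c'N0; size_lia.
have su'0 : (0 < size u')%N by rewrite size_poly_gt0.
have su0 : (0 < size u)%N by rewrite size_poly_gt0.
have sv0 : (0 < size v)%N by rewrite size_poly_gt0.
have sv'0 : (0 < size v')%N by rewrite size_poly_gt0.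
have su : size u = 1%N.
  (* If deg u = 1, then [c] has degree 2, so [v'] is -x u' and nonconstant, whereas deg u + deg v' =
     1 makes it constant. *)
  have [//|su1] := eqVneq (size u) 1%N.
  have sc : size c = 3%N.
    rewrite -(size_scale c a0) -Ec size_polyDl mulrC size_mulX //; size_lia.
  have: v' = - ('X * u') by apply: c'0; rewrite sc.
  by move/(congr1 (fun p : {poly F} => size p)); rewrite size_polyN mulrC size_mulX //; size_lia.
(* If [c] is nonconstant, then c' = 0 and d' = u' is nonzero, while the constant [u] leaves [d] with
   the degree of [c]: the pair [d], [d'] contradicts [invariant_pair_const]. *)
rewrite su eqxx /= leqNgt; apply/negP => sc.
have v'E := c'0 sc.
have c'Z : c' = 0.
  move: Ec'; rewrite v'E subrr => /esym/eqP; rewrite scaler_eq0 (negPf Na0) /=.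
  by move/eqP.
have d'0 : d' != 0 by rewrite d'E c'Z add0r.
have sd : size d = size c by rewrite dE size_polyDl // su.
have d0 : d != 0 by rewrite -size_poly_gt0 sd; size_lia.
by have := invariant_pair_const a0 Cd d0 d'0; size_lia.
Qed.

(** * Solving the functional equations for the structure polynomials *)

Local Notation half n := (n%:~R / 2 : F).

Lemma intF_eq0 (n : int) : (n%:~R == 0 :> F) = (n == 0).
Proof. by case: n => n; rewrite ?NegzE ?mulrNz ?oppr_eq0 -pmulrn charF. Qed.

Lemma int_step_ind (P : int -> Prop) : P 0 ->
  (forall n, P n -> P (n + 1)) -> (forall n, P n -> P (n - 1)) -> forall n, P n.
Proof.
move=> P0 Pp Pm; elim/int_ind=> // n /[dup] H.
  by move/Pp; rewrite -addn1 PoszD.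
by move/Pm; rewrite -addn1 PoszD opprD.
Qed.

(* Instantiated with the values on the generators: G_{n/2} 1_0 = u_n(y), G_{n/2} 1_1 = v_n(x),
   I_{k+1/2} 1_0 = c_k(x) and I_{k+1/2} 1_1 = d_k(y). *)
Section StructurePolynomials.
Variables u v c d : int -> {poly F}.
Hypothesis u0 : u 0 = 1.
Hypothesis v0 : v 0 = 'X.
Hypothesis GG0 : forall k : int, let n := 2 * k + 1 in
  (u (- n))^[half n] * v n + (u n)^[half (- n)] * v (- n) = -2 *: 'X.
Hypothesis GG1 : forall k : int, let n := 2 * k + 1 in
  (v (- n))^[half n] * u n + (v n)^[half (- n)] * u (- n) = -2 *: 'X.
Hypothesis GI0 : forall k : int, let n := 2 * k + 1 in 'X * u n + v n = half n *: c k.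
Hypothesis GI1 : forall k : int, let n := 2 * k + 1 in
  v n + ('X + (half n)%:P) * u n = half n *: d k.
Hypothesis II0 : forall k l : int,
  (c l)^[half (2 * k + 1)] * c k = (c k)^[half (2 * l + 1)] * c l.
Hypothesis II1 : forall k l : int,
  (d l)^[half (2 * k + 1)] * d k = (d k)^[half (2 * l + 1)] * d l.
Hypothesis IG0 : forall k n : int,
  (u n)^[half (2 * k + 1)] * d k - (c k)^[half n] * u n = u (2 * k + 1 + n).
Hypothesis IG1 : forall k n : int,
  (v n)^[half (2 * k + 1)] * c k - (d k)^[half n] * v n = v (2 * k + 1 + n).

Let two0 : 2 != 0 :> F. Proof. by rewrite charF. Qed.

Let half0 k : half (2 * k + 1) != 0.
Proof. by rewrite mulf_neq0 ?invr_eq0 // intF_eq0; lia. Qed.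

Let halfN n : half (- n) = - half n.
Proof. by rewrite mulrNz mulNr. Qed.

(** The relations for [G_0, G_r] on the two parities differ by r u_r, and r is nonzero. *)
Let dE k : d k = c k + u (2 * k + 1).
Proof.
apply: (scalerI (half0 k)); rewrite scalerDr -GI0 -GI1 -!mul_polyC; ring.
Qed.

Let odd_const k : (size (u (2 * k + 1)) == 1%N) && (size (c k) <= 1)%N.
Proof.
(* If r = k + 1/2, then -r = (-k - 1) + 1/2. *)
have kN : - (2 * k + 1) = 2 * (- k - 1) + 1 by lia.
apply: (@half_integer_const _ _ (u (- (2 * k + 1))) (v (2 * k + 1))
   (v (- (2 * k + 1))) _ (c (- k - 1)) (d k) (d (- k - 1)) (half0 k)).
- by rewrite -halfN; exact: GG0.
- by rewrite -halfN; exact: GG1.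
- exact: GI0.
- by rewrite -halfN kN; exact: GI0.
- by rewrite -halfN kN; exact: II0.
- by rewrite -halfN kN; exact: II1.
- exact: dE.
- by rewrite kN; exact: dE.
Qed.

(** Once the half-integral [u] and all [c] are constants, I_{1/2} and I_{-1/2} shift the index of G
    by one step up or down, so recursion from index 0 gives every [v n]; then [c] is read off from
    [G_0, G_r]. *)
Lemma structure_polynomials : exists mu alpha : F, [/\ mu != 0,
  forall n, u n = (mu ^ n)%:P,
  forall n, v n = ((- 1) ^ n * mu ^ n) *: ('X + (n%:~R * alpha)%:P),
  forall k, c k = (- 2 * mu ^ (2 * k + 1) * alpha)%:P &
  forall k, d k = (mu ^ (2 * k + 1) * (1 - 2 * alpha))%:P].
Proof.
have cC k : c k = ((c k)`_0)%:P by apply: size1_polyC; case/andP: (odd_const k).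
have uC k : u (2 * k + 1) = ((u (2 * k + 1))`_0)%:P.
  by apply: size1_polyC; case/andP: (odd_const k) => /eqP ->.
set mu := (u 1)`_0.
have u1 : u 1 = mu%:P by have := uC 0; rewrite mulr0 add0r.
have mu0 : mu != 0.
  have := odd_const 0; rewrite mulr0 add0r u1 => /andP [/eqP s _].
  by rewrite -polyC_eq0 -size_poly_eq0 s.
(* Translations fix constants, so [IG0] reduces to multiplication by d_k - c_k, which is
   [u (2 * k + 1)]. *)
have uS_odd k l : u (2 * k + 1 + (2 * l + 1)) = u (2 * k + 1) * u (2 * l + 1).
  by rewrite -IG0 dE (cC k) (uC k) (uC l) !(comp_polyD, comp_polyC); ring.
have uCC n : exists x, u n = x%:P.
  (* An even index is the sum of an odd index and 1, so [uS_odd] covers it. *)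
  have [[k ->]|[k ->]] : (exists k, n = 2 * k + 1) \/
      (exists k, n = 2 * k + 1 + (2 * 0 + 1)).
  - case: (boolP (intdiv.modz n 2 == 0)) => H;
      [right; exists (intdiv.divz n 2 - 1)|left; exists (intdiv.divz n 2)]; lia.
  - by exists (u (2 * k + 1))`_0.
  - by rewrite uS_odd (uC k) (uC 0) -polyCM; eexists.
have uS n : u (n + 1) = mu%:P * u n.
  have [x ux] := uCC n.
  have := IG0 0 n; rewrite mulr0 add0r [1 + n]addrC => <-.
  by rewrite dE mulr0 add0r u1 ux (cC 0) !(comp_polyD, comp_polyC); ring.
have uE n : u n = (mu ^ n)%:P.
  elim/int_step_ind: n => [|n IH|n IH]; first by rewrite u0 expr0z.
    by rewrite uS IH expfzDr // polyCM mulrC.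
  apply: (@mulfI _ mu%:P); rewrite ?polyC_eq0 // -uS subrK IH -polyCM.
  by rewrite -{2}[mu]expr1z -expfzDr // addrC subrK.
set C := (c 0)`_0; have c0 : c 0 = C%:P := cC 0.
(* Solves I_{1/2} 1_0 = -2 alpha mu, the value prescribed in N_1. *)
set alpha := - C / (2 * mu).
have CE : C = - 2 * alpha * mu by rewrite /alpha; field; rewrite mu0 two0.
clearbody alpha.
have d0 : d 0 = (C + mu)%:P by rewrite dE mulr0 add0r c0 u1 polyCD.
have v1 : v 1 = - mu *: ('X + alpha%:P).
  have := GI0 0; rewrite /= mulr0 add0r u1 c0 CE => /(canRL (addKr _)) ->.
  rewrite -mulrA mul1r -!mul_polyC -polyCM.
  have -> : 2^-1 * (- 2 * (alpha * mu)) = - (alpha * mu) by field.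
  by rewrite !polyCN polyCM; ring.
have um1 : u (- 1) = (mu^-1)%:P by rewrite uE.
(* The relation [I_{-1/2}, G_{1/2}] = G_0 on 1_1 leaves the constant term D mu / 2 + alpha = 0. *)
have cm1 : c (- 1) = (- 2 * alpha / mu)%:P.
  have := IG1 (-1) 1; rewrite (_ : 2 * -1 + 1 = -1) // addNr v0 dE um1 v1.
  rewrite (cC (-1)) !(comp_polyD, comp_polyZ, comp_polyC, comp_polyX) => E.
  set D := (c (-1))`_0 in E *; congr (_%:P).
  have : (D * mu / 2 + alpha)%:P = 0.
    apply/eqP; rewrite -(subrr 'X) -{1}E -subr_eq0; apply/eqP.
    have -> : (-1)%:~R / 2 = - (2^-1) :> F by rewrite mulrNz mulN1r.
    rewrite -!mul_polyC !polyCD !polyCN !polyCM.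
    have : (mu%:P * (mu^-1)%:P = 1) by rewrite -polyCM divff.
    move: (mu^-1)%:P (2^-1)%:P => m h Em.
    by ring: Em.
  move/eqP; rewrite polyC_eq0 addr_eq0 => /eqP aE.
  have -> : alpha = - (D * mu / 2) by rewrite aE opprK.
  by field; rewrite mu0 two0.
have dm1 : d (- 1) = ((1 - 2 * alpha) / mu)%:P.
  by rewrite dE cm1 um1 -polyCD; congr _%:P; field.
have vE n : v n = (- mu) ^ n *: ('X + (n%:~R * alpha)%:P).
  elim/int_step_ind: n => [|n IH|n IH].
  - by rewrite v0 expr0z mulr0z mul0r addr0 scale1r.
  - have := IG1 0 n; rewrite mulr0 add0r [1 + n]addrC => <-.
    rewrite IH d0 c0 CE !(comp_polyD, comp_polyZ, comp_polyC, comp_polyX) expfzDr ?oppr_eq0 //.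
    rewrite intrD -!mul_polyC.
    move: ((- mu) ^ n) (n%:~R) => e x.
    have h2 : (2^-1)%:P * 2 = 1 :> {poly F} by rewrite -(polyC_natr _ 2) -polyCM mulVf.
    rewrite expr1z mul1r !(polyCD, polyCM, polyCN, polyC_natr).
    move: (2^-1)%:P h2 => h h2; apply/eqP; rewrite -subr_eq0; apply/eqP.
    transitivity (e%:P * alpha%:P * mu%:P * (1 - h * 2)); first by ring.
    by rewrite h2 subrr !mulr0.
  - have := IG1 (-1) n; rewrite (_ : 2 * -1 + 1 = -1) // [-1 + n]addrC => <-.
    rewrite IH dm1 cm1 !(comp_polyD, comp_polyZ, comp_polyC, comp_polyX) expfzDr ?oppr_eq0 //.
    have h2 : (2^-1)%:P * 2 = 1 :> {poly F} by rewrite -(polyC_natr _ 2) -polyCM mulVf.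
    rewrite intrD exprN1 invrN -!mul_polyC.
    move: ((- mu) ^ n) (n%:~R) (mu^-1) => e x m.
    rewrite (_ : (-1)%:~R = -1 :> F) // mulN1r !(polyCD, polyCM, polyCN, polyC_natr).
    move: (2^-1)%:P h2 => h h2; apply/eqP; rewrite -subr_eq0; apply/eqP.
    transitivity (- e%:P * alpha%:P * m%:P * (1 - h * 2)); first by ring.
    by rewrite h2 subrr !mulr0.
have cE k : c k = (- 2 * mu ^ (2 * k + 1) * alpha)%:P.
  apply: (scalerI (half0 k)); rewrite -GI0 uE vE.
  have -> : (- mu) ^ (2 * k + 1) = - mu ^ (2 * k + 1).
    rewrite -mulN1r expfzMl [(-1) ^ _]expfzDr ?oppr_eq0 ?oner_eq0 // -exprz_exp.
    have -> : (- 1) ^ 2 = 1 :> F by apply: etrans (sqrrN 1) (expr1n F 2).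
    by rewrite exp1rz mul1r mulN1r.
  rewrite -!mul_polyC -polyCM; move: (mu ^ _) ((2 * k + 1)%:~R) => e x.
  have -> : x / 2 * (-2 * e * alpha) = - (x * e * alpha) by field.
  by rewrite !(polyCD, polyCM, polyCN); ring.
exists mu, alpha; split=> // [n|k].
  by rewrite vE -expfzMl mulN1r.
by rewrite dE cE uE -polyCD; congr _%:P; ring.
Qed.
End StructurePolynomials.
End Translations.

(** * Linear maps, parity change and intertwiners *)

Lemma natCC_eq0 (n : nat) : (n%:R == 0 :> CC) = (n == 0%N).
Proof. exact: (pnatr_eq0 (complex R)). Qed.

Section LinearMaps.
Context {U V : lmodType CC} {f : U -> V} (linf : lin f).

Lemma lin_D x y : f (x + y) = f x + f y.
Proof. by have := linf 1 x y; rewrite !scale1r. Qed.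

Lemma lin_0 : f 0 = 0.
Proof. by apply: (addrI (f 0)); rewrite -lin_D !addr0. Qed.

Lemma lin_Z a x : f (a *: x) = a *: f x.
Proof. by rewrite -[a *: x]addr0 linf lin_0 addr0. Qed.

Lemma lin_N x : f (- x) = - f x.
Proof. by rewrite -scaleN1r lin_Z scaleN1r. Qed.

Lemma lin_B x y : f (x - y) = f x - f y.
Proof. by rewrite lin_D lin_N. Qed.
End LinearMaps.

Lemma lin_can (U V : lmodType CC) (f : U -> V) (g : V -> U) :
  lin f -> cancel f g -> cancel g f -> lin g.
Proof. by move=> lf fK gK a x y; apply: (can_inj fK); rewrite lf !gK. Qed.

(** The defining relations do not distinguish the two parities. This transfers every result on the
    even part to the odd part. *)
Lemma Tmodule_swap (V0 V1 : lmodType CC)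
    (L0 I0 : int -> V0 -> V0) (L1 I1 : int -> V1 -> V1)
    (G0 : int -> V0 -> V1) (G1 : int -> V1 -> V0) :
  is_Tmodule L0 I0 L1 I1 G0 G1 -> is_Tmodule L1 I1 L0 I0 G1 G0.
Proof.
move=> [l1 [l2 [l3 [l4 [l5 [l6 [LL [LI [LG [II [IG [GGe GGo]]]]]]]]]]]].
have sw (A B : V0) (A' B' : V1) : (A, A') = (B, B') -> (A', A) = (B', B).
  by case=> -> ->.
do 6![split=> //].
split; first by move=> m n [x y]; exact: sw (LL m n (y, x)).
split; first by move=> m n [x y]; exact: sw (LI m n (y, x)).
split; first by move=> m n [x y]; exact: sw (LG m n (y, x)).
split; first by move=> m n [x y]; exact: sw (II m n (y, x)).
split; first by move=> m n [x y]; exact: sw (IG m n (y, x)).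
split; first by move=> m n k [x y] e; exact: sw (GGe m n k (y, x) e).
by move=> m n k [x y] e; exact: sw (GGo m n k (y, x) e).
Qed.

(** From S T_U = (T_V + a) S follows S f(T_U) = f(T_V + a) S, so [S] is determined by its value on
    the generator. *)
Lemma intertwine (U V : lmodType CC) (phi : {poly CC} -> U) (psi : {poly CC} -> V)
    (TU : U -> U) (TV : V -> V) (S : U -> V) (a : CC) (s : {poly CC}) :
  lin phi -> lin psi -> lin S ->
  (forall f, phi ('X * f) = TU (phi f)) -> (forall f, psi ('X * f) = TV (psi f)) ->
  (forall x, S (TU x) = TV (S x) + a *: S x) -> S (phi 1) = psi s ->
  forall f, S (phi f) = psi (shift a f * s).
Proof.
move=> lphi lpsi lS phiX psiX ST S1; elim/poly_ind=> [|f c IH].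
  by rewrite /shift comp_poly0 mul0r !lin_0.
rewrite mulrC -[c%:P]mulr1 mul_polyC (lin_D lphi) (lin_Z lphi) (lin_D lS) (lin_Z lS).
rewrite phiX ST IH S1 -psiX -!(lin_Z lpsi) -!(lin_D lpsi); congr psi.
rewrite /shift comp_polyD comp_polyM comp_polyX comp_polyZ -!mul_polyC.
by rewrite comp_polyC; ring.
Qed.

(** * From coordinates on both parities to the isomorphism with N_1 *)

Section Coordinates.
Variables (V0 V1 : lmodType CC).
Variables (L0 I0 : int -> V0 -> V0) (L1 I1 : int -> V1 -> V1)
          (G0 : int -> V0 -> V1) (G1 : int -> V1 -> V0).
Hypothesis modW : is_Tmodule L0 I0 L1 I1 G0 G1.
Variables (phi0 : {poly CC} -> V0) (psi0 : V0 -> {poly CC}).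
Variables (phi1 : {poly CC} -> V1) (psi1 : V1 -> {poly CC}).
Hypotheses (lphi0 : lin phi0) (lphi1 : lin phi1).
Hypotheses (phi0K : cancel phi0 psi0) (psi0K : cancel psi0 phi0).
Hypotheses (phi1K : cancel phi1 psi1) (psi1K : cancel psi1 phi1).
Hypothesis phi0X : forall f, phi0 ('X * f) = L0 0 (phi0 f).
Hypothesis phi1X : forall f, phi1 ('X * f) = L1 0 (phi1 f).
Hypothesis G0phi0 : forall f, G0 0 (phi0 f) = phi1 f.

Local Notation half n := (n%:~R / 2 : CC).

(** With G_0 1_0 = 1_1, the relations between the G's and I's at the generators are the equations of
    [structure_polynomials]. The remaining L_m follow from [G_0, G_m] = 2 L_m. *)
Lemma iso_of_coordinates :
  exists mu alpha : CC, mu != 0 /\ iso_to_N L0 I0 L1 I1 G0 G1 1 mu alpha.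
Proof.
have [lL0 [lL1 [lI0 [lI1 [lG0 [lG1 [_ [LI [LG [II [IG [GGe GGo]]]]]]]]]]]] := modW.
have two0 : 2 != 0 :> CC by rewrite natCC_eq0.
have hodd (k : int) : k%:~R + 1 / 2 = half (2 * k + 1).
  by rewrite intrD intrM; field.
pose u n := psi1 (G0 n (phi0 1)); pose v n := psi0 (G1 n (phi1 1)).
pose c k := psi0 (I0 k (phi0 1)); pose d k := psi1 (I1 k (phi1 1)).
have G0E n f : G0 n (phi0 f) = phi1 (shift (half n) f * u n).
  apply: (intertwine lphi0 lphi1 (lG0 n) phi0X phi1X) f; last by rewrite psi1K.
  (* The commutator with L_0 reads G_p L_0 = (L_0 + p) G_p, where p = n/2 is the translation. *)
  move=> x; have /(congr1 snd) /= := LG 0 n (x, 0).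
  rewrite mulr0 !add0r mulNr scaleNr => E.
  by apply/eqP; rewrite eq_sym addrC -subr_eq0 -addrA E subrr.
have G1E n f : G1 n (phi1 f) = phi0 (shift (half n) f * v n).
  apply: (intertwine lphi1 lphi0 (lG1 n) phi1X phi0X) f; last by rewrite psi0K.
  move=> x; have /(congr1 fst) /= := LG 0 n (0, x).
  rewrite mulr0 !add0r mulNr scaleNr => E.
  by apply/eqP; rewrite eq_sym addrC -subr_eq0 -addrA E subrr.
have I0E k f : I0 k (phi0 f) = phi0 (shift (half (2 * k + 1)) f * c k).
  apply: (intertwine lphi0 lphi0 (lI0 k) phi0X phi0X) f; last by rewrite psi0K.
  move=> x; have /(congr1 fst) /= := LI 0 k (x, 0).
  rewrite add0r -hodd scaleNr => E.
  by apply/eqP; rewrite eq_sym addrC -subr_eq0 -addrA E subrr.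
have I1E k f : I1 k (phi1 f) = phi1 (shift (half (2 * k + 1)) f * d k).
  apply: (intertwine lphi1 lphi1 (lI1 k) phi1X phi1X) f; last by rewrite psi1K.
  move=> x; have /(congr1 snd) /= := LI 0 k (0, x).
  rewrite add0r -hodd scaleNr => E.
  by apply/eqP; rewrite eq_sym addrC -subr_eq0 -addrA E subrr.
have shiftC a (x : CC) : shift a x%:P = x%:P by rewrite /shift comp_polyC.
have inj0 := can_inj phi0K; have inj1 := can_inj phi1K.
have opp_even n : ((-1) ^ (2 * n) : CC) = 1.
  rewrite -exprz_exp; have -> : (- 1) ^ 2 = 1 :> CC.
    by apply: etrans (sqrrN 1) (expr1n _ 2).
  exact: exp1rz.
have opp_odd n : ((-1) ^ (2 * n + 1) : CC) = -1.
  by rewrite expfzDr ?oppr_eq0 ?oner_eq0 // opp_even mul1r.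
have shift1 a : shift a 1 = 1 by exact: shiftC.
have u0 : u 0 = 1 by rewrite /u G0phi0 phi1K.
have GGe0 n n' m f : n + n' = 2 * m ->
    phi0 (shift (half n) (shift (half n') f * u n') * v n +
          shift (half n') (shift (half n) f * u n) * v n')
    = ((-1) ^ n * 2) *: L0 m (phi0 f).
  move=> E; have /(congr1 fst) /= := GGe n n' m (phi0 f, 0) E.
  by rewrite !G0E !G1E -(lin_D lphi0).
have GGe1 n n' m f : n + n' = 2 * m ->
    phi1 (shift (half n) (shift (half n') f * v n') * u n +
          shift (half n') (shift (half n) f * v n) * u n')
    = ((-1) ^ n * 2) *: L1 m (phi1 f).
  move=> E; have /(congr1 snd) /= := GGe n n' m (0, phi1 f) E.
  by rewrite !G1E !G0E -(lin_D lphi1).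
have v0 : v 0 = 'X.
  have := GGe0 0 0 0 1 erefl; rewrite expr0z mul1r !shift1 !mul1r u0 shift1 mul1r.
  rewrite -phi0X mulr1 -(lin_Z lphi0) => /inj0.
  by move=> E; apply: (scalerI two0); rewrite -E scaler_nat mulr2n.
have shift0 f : shift (half 0) f = f.
  by rewrite /shift mulr0z mul0r addr0 comp_polyXr.
have sgn0 n : (-1) ^ (0 + 1) * ((0%:~R - n%:~R) / 2) = half n :> CC.
  by rewrite !add0r expr1z mulN1r mulNr opprK.
have [||||||||mu [alpha [mu0 uE vE cE dE]]] :=
    @structure_polynomials CC natCC_eq0 u v c d u0 v0.
- move=> k n; have := GGe0 n (- n) 0 1 (subrr n).
  by rewrite opp_odd mulN1r -phi0X -(lin_Z lphi0) !shift1 !mul1r mulr1 => /inj0.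
- move=> k n; have := GGe1 n (- n) 0 1 (subrr n).
  by rewrite opp_odd mulN1r -phi1X -(lin_Z lphi1) !shift1 !mul1r mulr1 => /inj1.
- move=> k n; have /(congr1 fst) /= := GGo 0 n k (phi0 1, 0) (add0r n).
  rewrite !G0E !G1E -(lin_D lphi0) !shift1 !mul1r u0 shift1 mul1r shift0 v0 sgn0.
  by rewrite -{1}(psi0K (I0 k _)) -(lin_Z lphi0) => /inj0 <-; rewrite mulrC.
- move=> k n; have /(congr1 snd) /= := GGo 0 n k (0, phi1 1) (add0r n).
  rewrite !G1E !G0E -(lin_D lphi1) !shift1 !mul1r u0 mulr1 shift0 v0 sgn0.
  rewrite -{1}(psi1K (I1 k _)) -(lin_Z lphi1) => /inj1 <-.
  by rewrite /shift comp_polyX.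
- move=> k l; have /(congr1 fst) /= := II k l (phi0 1, 0).
  rewrite !I0E -(lin_B lphi0) -(lin_0 lphi0) => /inj0 /eqP.
  by rewrite !shift1 !mul1r subr_eq0 => /eqP.
- move=> k l; have /(congr1 snd) /= := II k l (0, phi1 1).
  rewrite !I1E -(lin_B lphi1) -(lin_0 lphi1) => /inj1 /eqP.
  by rewrite !shift1 !mul1r subr_eq0 => /eqP.
- move=> k n; have /(congr1 snd) /= := IG k n (phi0 1, 0).
  by rewrite I0E !G0E I1E -(lin_B lphi1) !shift1 !mul1r => /inj1.
- move=> k n; have /(congr1 fst) /= := IG k n (0, phi1 1).
  by rewrite I1E !G1E I0E -(lin_B lphi0) !shift1 !mul1r => /inj0.
exists mu, alpha; split=> //; exists psi0, psi1.
split; first exact: lin_can phi0K psi0K.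
split; first exact: lin_can phi1K psi1K.
split; first by exists phi0.
split; first by exists phi1.
have twice_inj (V : lmodType CC) (x y : V) : 2%:R *: x = 2%:R *: y -> x = y.
  by apply: scalerI; rewrite natCC_eq0.
have halfm (m : int) : half (2 * m) = m%:~R by rewrite intrM; field.
have L0E m f : L0 m (phi0 f) = phi0 (NL0 mu alpha m f).
  apply: twice_inj; have := GGe0 0 (2 * m) m f (add0r _).
  rewrite expr0z mul1r => <-; rewrite -(lin_Z lphi0); congr phi0.
  rewrite !shift0 u0 v0 mulr1 uE vE halfm opp_even mul1r intrM.
  rewrite /NL0 -!mul_polyC -mulrA !polyCM polyC_natr; ring.
have L1E m f : L1 m (phi1 f) = phi1 (NL1 mu alpha m f).
  apply: twice_inj; have := GGe1 0 (2 * m) m f (add0r _).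
  rewrite expr0z mul1r => <-; rewrite -(lin_Z lphi1); congr phi1.
  rewrite !shift0 u0 v0 mulr1 uE vE halfm opp_even mul1r intrM.
  rewrite /NL1 -!mul_polyC -mulrA.
  (* Here G_m also translates the factor x of G_0 1_1. Averaging x + m with x + 2m alpha produces
     the shift of alpha by 1/2 on the odd part. *)
  have -> : shift m%:~R (f * 'X) = shift m%:~R f * ('X + m%:~R%:P).
    by rewrite /shift comp_polyM comp_polyX.
  have -> : m%:~R%:P = (2%:R)%:P * (m%:~R * (1 / 2) : CC)%:P.
    by rewrite -polyCM; congr _%:P; field.
  by rewrite mulrDr polyCD !polyCM polyC_natr; ring.
have at0 (U : Type) (A : V0 -> U) (B : {poly CC} -> U) :
    (forall f, A (phi0 f) = B f) -> forall x, A x = B (psi0 x).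
  by move=> AB x; rewrite -{1}(psi0K x) AB.
have at1 (U : Type) (A : V1 -> U) (B : {poly CC} -> U) :
    (forall f, A (phi1 f) = B f) -> forall x, A x = B (psi1 x).
  by move=> AB x; rewrite -{1}(psi1K x) AB.
split=> [m x|]; first by rewrite (at0 _ _ _ (L0E m)) phi0K.
split=> [m x|]; first by rewrite (at1 _ _ _ (L1E m)) phi1K.
split=> [k x|].
  rewrite (at0 _ _ _ (I0E k)) phi0K cE /NI0 exp1rz mulr1 hodd.
  by rewrite mulrC mul_polyC.
split=> [k x|].
  rewrite (at1 _ _ _ (I1E k)) phi1K dE /NI1 exp1rz mul1r hodd.
  by rewrite mulrC mul_polyC.
split=> n x.
  by rewrite (at0 _ _ _ (G0E n)) phi1K uE /NG0 exp1rz mul1r mulrC mul_polyC.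
rewrite (at1 _ _ _ (G1E n)) phi0K vE /NG1 -!mul_polyC; ring.
Qed.
End Coordinates.

(** * Modules over the polynomial ring in one operator *)

Section PolynomialAction.
Variables (V : lmodType CC) (T : V -> V).
Hypothesis linT : lin T.
Implicit Types (p q : {poly CC}) (v x y e : V).

Definition polyact (p : {poly CC}) (v : V) : V :=
  \sum_(i < size p) p`_i *: iter i T v.

Lemma polyact_widen n p v : (size p <= n)%N ->
  polyact p v = \sum_(i < n) p`_i *: iter i T v.
Proof.
move=> pn; rewrite /polyact -!(big_mkord xpredT (fun i => p`_i *: iter i T v)).
rewrite [RHS](big_cat_nat (leq0n _) pn) //= [X in _ + X]big_nat_cond [X in _ + X]big1 ?addr0 // => i.
by rewrite andbT => /andP [pi _]; rewrite nth_default ?scale0r.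
Qed.

Lemma polyactD p q v : polyact (p + q) v = polyact p v + polyact q v.
Proof.
pose n := maxn (size p) (size q).
rewrite !(@polyact_widen n) ?leq_maxl ?leq_maxr ?size_polyD // -big_split /=.
by apply: eq_bigr => i _; rewrite coefD scalerDl.
Qed.

Lemma polyactZ a p v : polyact (a *: p) v = a *: polyact p v.
Proof.
rewrite (@polyact_widen (size p)) ?size_scale_leq // /polyact scaler_sumr.
by apply: eq_bigr => i _; rewrite coefZ scalerA.
Qed.

Lemma polyactC c v : polyact c%:P v = c *: v.
Proof.
by rewrite (@polyact_widen 1) ?size_polyC_leq1 // big_ord1 coefC eqxx.
Qed.

Lemma polyact0 v : polyact 0 v = 0.
Proof. by rewrite polyactC scale0r. Qed.

Lemma polyact1 v : polyact 1 v = v.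
Proof. by rewrite polyactC scale1r. Qed.

Lemma iter_lin i : lin (iter i T).
Proof. by elim: i => [|i IH] a x y //=; rewrite IH linT. Qed.

Lemma polyact_lin p : lin (polyact p).
Proof.
move=> a x y; rewrite /polyact scaler_sumr -big_split /=; apply: eq_bigr => i _.
by rewrite iter_lin scalerDr !scalerA mulrC.
Qed.

Lemma polyactMX p v : polyact (p * 'X) v = T (polyact p v).
Proof.
rewrite (@polyact_widen (size p).+1).
  rewrite big_ord_recl coefMX scale0r add0r /polyact.
  rewrite (big_morph T (lin_D linT) (lin_0 linT)).
  by apply: eq_bigr => i _; rewrite coefMX (lin_Z linT).
by have [->|p0] := eqVneq p 0; rewrite ?mul0r ?size_poly0 // size_mulX.
Qed.

Lemma polyactM p q v : polyact (p * q) v = polyact p (polyact q v).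
Proof.
elim/poly_ind: p => [|p c IH]; first by rewrite mul0r !polyact0.
rewrite mulrDl !polyactD mulrAC !polyactMX IH -[c%:P]mulr1 mul_polyC.
by rewrite -scalerAl mul1r !polyactZ polyact1.
Qed.

Lemma polyact_phi_lin e : lin (polyact^~ e).
Proof. by move=> a p q; rewrite polyactD polyactZ. Qed.

(* Over a PID, dividing a relation [p x + q y = 0] by [gcd p q] gives coprime
   [p', q'], and Bezout coefficients [s p' + t q' = 1] turn [t x - s y] into a
   common generator. *)
Lemma dependent_pair_cyclic x y p q :
  (forall r v, polyact r v = 0 -> r = 0 \/ v = 0) ->
  (p != 0) || (q != 0) -> polyact p x + polyact q y = 0 ->
  (forall v, exists r s, v = polyact r x + polyact s y) ->
  exists e, forall v, exists r, v = polyact r e.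
Proof.
move=> tf pq0 rel gen.
set g := gcdp p q; have g0 : g != 0 by rewrite gcdp_eq0 negb_and.
have pE := divpK (dvdp_gcdl p q); have qE := divpK (dvdp_gcdr p q).
have /Bezout_eq1_coprimepP [[s t] /= st] := coprimep_div_gcd pq0.
rewrite -/g in pE qE st; move: (p %/ g) (q %/ g) pE qE st => p' q' pE qE st.
have rel' : polyact p' x + polyact q' y = 0.
  have := rel; rewrite -pE -qE ![_ * g]mulrC !polyactM -(lin_D (polyact_lin g)).
  by case/tf => // g0'; rewrite g0' eqxx in g0.
have yE : polyact q' y = - polyact p' x.
  by apply/eqP; rewrite -addr_eq0 addrC rel'.
have xE : polyact p' x = - polyact q' y by rewrite yE opprK.
exists (polyact t x - polyact s y) => v; have [a [b ->]] := gen v.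
(* The generator is sent to x by [q'] and to -y by [p']. *)
exists (a * q' - b * p').
have e1 : polyact q' (polyact t x - polyact s y) = x.
  rewrite (lin_B (polyact_lin q')) -!polyactM mulrC [q' * s]mulrC !polyactM.
  rewrite yE (lin_N (polyact_lin s)) opprK -!polyactM -polyactD addrC st.
  exact: polyact1.
have e2 : polyact p' (polyact t x - polyact s y) = - y.
  rewrite (lin_B (polyact_lin p')) -!polyactM mulrC [p' * s]mulrC !polyactM.
  rewrite xE (lin_N (polyact_lin t)) -opprD -!polyactM -polyactD addrC st.
  by rewrite polyact1.
rewrite polyactD -(scaleN1r (b * p')) polyactZ scaleN1r !polyactM e1 e2.
by rewrite (lin_N (polyact_lin b)) opprK.
Qed.
End PolynomialAction.

Lemma polyact_commute (U V : lmodType CC) (TU : U -> U) (TV : V -> V) (S : U -> V) p v :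
  lin S -> (forall x, S (TU x) = TV (S x)) -> S (polyact TU p v) = polyact TV p (S v).
Proof.
move=> lS ST; rewrite /polyact (big_morph S (lin_D lS) (lin_0 lS)).
apply: eq_bigr => i _; rewrite (lin_Z lS); congr (_ *: _).
by elim: (i : nat) => //= n IH; rewrite ST IH.
Qed.

Lemma L0polyE (V0 V1 : lmodType CC) (L0 : int -> V0 -> V0) (L1 : int -> V1 -> V1) p w :
  L0poly L0 L1 p w = (polyact (L0 0) p w.1, polyact (L1 0) p w.2).
Proof.
rewrite /L0poly /polyact.
have it i : iter i (opL L0 L1 0) w = (iter i (L0 0) w.1, iter i (L1 0) w.2).
  by elim: i => [|i IH] /=; [case: (w) | rewrite IH].
apply: (big_rec3 (fun x y z => x = (y, z))) => // i x y z _ ->.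
by rewrite it.
Qed.

Lemma L0free_swap (V0 V1 : lmodType CC) (L0 : int -> V0 -> V0) (L1 : int -> V1 -> V1) :
  L0free_rank2 L0 L1 -> L0free_rank2 L1 L0.
Proof.
move=> [w1 [w2 [gen free]]]; exists (w1.2, w1.1), (w2.2, w2.1); split=> [[y x]|p q].
  by have [p [q]] := gen (x, y); rewrite !L0polyE => -[-> ->]; exists p, q; rewrite !L0polyE.
rewrite !L0polyE => -[e1 e2]; apply: free; rewrite !L0polyE.
by congr pair.
Qed.

(* Pad the 3 x 2 coefficient matrix with a zero column. *)
Lemma three_rows_dependent (F : idomainType) (a0 a1 a2 b0 b1 b2 : F) :
  exists r0 r1 r2, [/\ [|| r0 != 0, r1 != 0 | r2 != 0],
    r0 * a0 + r1 * a1 + r2 * a2 = 0 & r0 * b0 + r1 * b1 + r2 * b2 = 0].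
Proof.
pose A : 'M[F]_3 := \matrix_(i, j)
  nth 0 (nth [::] [:: [:: a0; b0; 0]; [:: a1; b1; 0]; [:: a2; b2; 0]] i) j.
have /eqP/det0P [r r0 rA] : \det A = 0.
  rewrite (expand_det_col _ ord_max) big1 // => i _; rewrite mxE.
  by case: i => [[|[|[|m]]] lti] //=; rewrite mul0r.
exists (r 0 0), (r 0 1), (r 0 2%:R); split.
- apply: contraNT r0; rewrite !negb_or !negbK => /and3P [/eqP e0 /eqP e1 /eqP e2].
  apply/eqP/rowP => -[[|[|[|i]]] lti] //; rewrite mxE.
  + by rewrite -[RHS]e0; congr (r _ _); apply: val_inj.
  + by rewrite -[RHS]e1; congr (r _ _); apply: val_inj.
  + by rewrite -[RHS]e2; congr (r _ _); apply: val_inj.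
- have /rowP/(_ 0) := rA; rewrite !mxE !big_ord_recl big_ord0 !mxE /= addr0 addrA => E.
  rewrite -[RHS]E; congr (_ * _ + _ * _ + _ * _); congr (r _ _); exact: val_inj.
- have /rowP/(_ 1) := rA; rewrite !mxE !big_ord_recl big_ord0 !mxE /= addr0 addrA => E.
  rewrite -[RHS]E; congr (_ * _ + _ * _ + _ * _); congr (r _ _); exact: val_inj.
Qed.

Definition torsion_free (V : lmodType CC) (T : V -> V) : Prop :=
  forall r v, polyact T r v = 0 -> r = 0 \/ v = 0.

Definition generates (V : lmodType CC) (T : V -> V) (e : V) : Prop :=
  forall v, exists r, v = polyact T r e.

(** * Consequences of freeness of rank two for each parity *)

Section FreeRankTwo.
Variables (V0 V1 : lmodType CC) (L0 : int -> V0 -> V0) (L1 : int -> V1 -> V1).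
Hypotheses (lL0 : lin (L0 0)) (lL1 : lin (L1 0)).
Hypothesis freeW : L0free_rank2 L0 L1.
Local Notation act0 := (polyact (L0 0)).
Local Notation act1 := (polyact (L1 0)).
Local Notation act := (L0poly L0 L1).

Let actM p q w : act (p * q) w = act p (act q w).
Proof. by rewrite !L0polyE /= (polyactM lL0) (polyactM lL1). Qed.

Let actD p q w : act (p + q) w = act p w + act q w.
Proof. by rewrite !L0polyE /= !polyactD. Qed.

Let act_D p w w' : act p (w + w') = act p w + act p w'.
Proof.
by rewrite !L0polyE (lin_D (polyact_lin lL0 p)) (lin_D (polyact_lin lL1 p)).
Qed.

(** In the basis, [r] multiplies both coordinates of (v, 0), and polynomials form a domain. *)
Lemma free_torsion_free : torsion_free (L0 0).
Proof.
have [w1 [w2 [gen free]]] := freeW.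
move=> r v rv; have [p [q E]] := gen (v, 0).
have : act r (v, 0) = 0 by rewrite L0polyE /= rv (lin_0 (polyact_lin lL1 r)).
rewrite E act_D -!actM => /free [/eqP + /eqP].
rewrite !mulf_eq0; have [->|_ /=] := eqVneq r 0; first by left.
move=> /eqP p0 /eqP q0; right; move: E.
by rewrite p0 q0 !L0polyE !polyact0 addr0 => /(congr1 fst).
Qed.

(** Three elements (x, 0), (y, 0), (0, z) of a rank 2 module are dependent. The odd component kills
    the coefficient of [z], so a nontrivial relation between [x] and [y] remains. *)
Lemma free_dependent (x y : V0) (z : V1) : z != 0 -> torsion_free (L1 0) ->
  exists p q : {poly CC}, ((p != 0) || (q != 0)) /\ act0 p x + act0 q y = 0.
Proof.
move=> z0 tf1; have [w1 [w2 [gen free]]] := freeW.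
have [a0 [b0 E0]] := gen (x, 0); have [a1 [b1 E1]] := gen (y, 0).
have [a2 [b2 E2]] := gen (0, z).
have [p [q [r [nz ra rb]]]] := three_rows_dependent a0 a1 a2 b0 b1 b2.
have : act p (x, 0) + act q (y, 0) + act r (0, z) = 0.
  transitivity (act (p * a0 + q * a1 + r * a2) w1 + act (p * b0 + q * b1 + r * b2) w2).
    rewrite E0 E1 E2 !act_D -!actM !actD [RHS]addrACA.
    by congr (_ + _); rewrite addrACA.
  by rewrite ra rb !L0polyE !polyact0 addr0.
rewrite !L0polyE /= !(lin_0 (polyact_lin lL0 _)) !(lin_0 (polyact_lin lL1 _)).
move=> [E]; rewrite !add0r => /tf1 [r0|ez]; last by rewrite ez eqxx in z0.
by exists p, q; split; [move: nz; rewrite r0 eqxx orbF | rewrite -[RHS]E addr0].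
Qed.
End FreeRankTwo.

Lemma coordinates (V : lmodType CC) (T : V -> V) (e : V) : lin T ->
  torsion_free T -> generates T e -> e != 0 ->
  exists psi, cancel (polyact T ^~ e) psi /\ cancel psi (polyact T ^~ e).
Proof.
move=> lT tf gen e0.
(* Some coefficient is chosen; torsion-freeness makes it unique, so [psi] is a two-sided inverse. *)
pose psi v := proj1_sig (constructive_indefinite_description _ (gen v)).
have psiK : cancel psi (polyact T ^~ e).
  by move=> v; rewrite /psi; case: constructive_indefinite_description.
exists psi; split=> // p; have := psiK (polyact T p e); move: (psi _) => q /eqP.
rewrite -subr_eq0 -(lin_B (polyact_phi_lin T e)) => /eqP /tf [/eqP|ez].
  by rewrite subr_eq0 => /eqP.
by rewrite ez eqxx in e0.
Qed.

(** * The odd operator G_0 as a square root of L_0 *)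

Section SquareRoot.
Variables (V0 V1 : lmodType CC).
Variables (L0 I0 : int -> V0 -> V0) (L1 I1 : int -> V1 -> V1)
          (G0 : int -> V0 -> V1) (G1 : int -> V1 -> V0).
Hypothesis modW : is_Tmodule L0 I0 L1 I1 G0 G1.

Lemma G_squared x : G1 0 (G0 0 x) = L0 0 x.
Proof.
have [_ [_ [_ [_ [_ [_ [_ [_ [_ [_ [_ [GG _]]]]]]]]]]]] := modW.
have /(congr1 fst) /= := GG 0 0 0 (x, 0) erefl.
rewrite expr0z mul1r -mulr2n -scaler_nat => /scalerI; apply.
by rewrite natCC_eq0.
Qed.

Lemma G_commutes x : G0 0 (L0 0 x) = L1 0 (G0 0 x).
Proof.
have [_ [_ [_ [_ [_ [_ [_ [_ [LG _]]]]]]]]] := modW.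
have /(congr1 snd) /= := LG 0 0 (x, 0).
by rewrite subrr mul0r scale0r => /eqP; rewrite subr_eq0 => /eqP ->.
Qed.

Lemma iso_of_generator e :
  torsion_free (L0 0) -> torsion_free (L1 0) -> e != 0 ->
  generates (L0 0) e -> generates (L1 0) (G0 0 e) ->
  exists mu alpha : CC, mu != 0 /\ iso_to_N L0 I0 L1 I1 G0 G1 1 mu alpha.
Proof.
have [lL0 [lL1 [_ [_ [lG0 [lG1 _]]]]]] := modW.
move=> tf0 tf1 e0 gen0 gen1.
have Ge0 : G0 0 e != 0.
  (* If G_0 e = 0, then L_0 e = G_0^2 e = 0, so e would be torsion. *)
  apply: contraNneq e0 => Ge.
  have : polyact (L0 0) 'X e = 0.
    by rewrite -[X in polyact _ X]mul1r (polyactMX (lL0 0)) polyact1 -G_squared Ge (lin_0 (lG1 0)).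
  by case/tf0 => [/eqP|->]; rewrite ?polyX_eq0.
have [psi0 [phi0K psi0K]] := coordinates (lL0 0) tf0 gen0 e0.
have [psi1 [phi1K psi1K]] := coordinates (lL1 0) tf1 gen1 Ge0.
apply: (iso_of_coordinates modW (polyact_phi_lin (L0 0) e)
          (polyact_phi_lin (L1 0) (G0 0 e)) phi0K psi0K phi1K psi1K).
- by move=> f; rewrite mulrC polyactMX.
- by move=> f; rewrite mulrC polyactMX.
- by move=> f; rewrite (polyact_commute f e (lG0 0) G_commutes).
Qed.
End SquareRoot.

(** * Each parity is nonzero and cyclic *)

Section RankOne.
Variables (V0 V1 : lmodType CC).
Variables (L0 I0 : int -> V0 -> V0) (L1 I1 : int -> V1 -> V1)
          (G0 : int -> V0 -> V1) (G1 : int -> V1 -> V0).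
Hypothesis modW : is_Tmodule L0 I0 L1 I1 G0 G1.
Hypothesis freeW : L0free_rank2 L0 L1.

(** If a basis vector w_1 is even and G_0 w_1 = 0, then L_0 w_1 = 0, against freeness. *)
Lemma odd_part_nonzero : exists z : V1, z != 0.
Proof.
have [lL0 [lL1 [_ [_ [lG0 [lG1 _]]]]]] := modW.
have [w1 [w2 [gen free]]] := freeW.
have [w1odd|] := eqVneq w1.2 0; last by exists w1.2.
have [Gw|] := eqVneq (G0 0 w1.1) 0; last by exists (G0 0 w1.1).
have : L0poly L0 L1 'X w1 + L0poly L0 L1 0 w2 = 0.
  rewrite !L0polyE !polyact0 addr0 w1odd (lin_0 (polyact_lin (lL1 0) _)).
  rewrite -[X in polyact _ X]mul1r (polyactMX (lL0 0)) polyact1.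
  by rewrite -(G_squared modW) Gw (lin_0 (lG1 0)).
by case/free => /eqP; rewrite polyX_eq0.
Qed.

(** The even components of a basis generate the even part, and a nonzero odd vector makes them
    dependent. *)
Lemma even_part_cyclic : torsion_free (L1 0) -> exists e, generates (L0 0) e.
Proof.
move=> tf1; have [lL0 [lL1 _]] := modW.
have [w1 [w2 [gen free]]] := freeW.
have [z z0] := odd_part_nonzero.
have [p [q [pq0 rel]]] := free_dependent (lL0 0) (lL1 0) freeW w1.1 w2.1 z0 tf1.
apply: (dependent_pair_cyclic (lL0 0) (free_torsion_free (lL0 0) (lL1 0) freeW) pq0 rel).
by move=> v; have [r [s]] := gen (v, 0); rewrite !L0polyE => -[-> _]; exists r, s.
Qed.
End RankOne.

(** * Choice of the parity *)

Lemma generates_scale (V : lmodType CC) (T : V -> V) (c : CC) (e : V) : lin T ->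
  c != 0 -> generates T e -> generates T (c *: e).
Proof.
move=> lT c0 gen v; have [r ->] := gen v; exists (c^-1 *: r).
by rewrite polyactZ (lin_Z (polyact_lin lT r)) scalerA mulVf ?scale1r.
Qed.

Theorem theorem4p3 (V0 V1 : lmodType CC)
    (L0 I0 : int -> V0 -> V0) (L1 I1 : int -> V1 -> V1)
    (G0 : int -> V0 -> V1) (G1 : int -> V1 -> V0) :
  is_Tmodule L0 I0 L1 I1 G0 G1 ->
  L0free_rank2 L0 L1 ->
  exists (lambda alpha mu : CC),
    lambda != 0 /\ mu ^+ 2 = lambda /\
    exists t : CC, (t = 1 \/ t = -1) /\
      (iso_to_N L0 I0 L1 I1 G0 G1 t mu alpha \/
       Pi_iso_to_N L0 I0 L1 I1 G0 G1 t mu alpha).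
Proof.
move=> modW freeW; have modPi := Tmodule_swap modW; have freePi := L0free_swap freeW.
have [lL0 [lL1 [_ [_ [lG0 [lG1 _]]]]]] := modW.
have tf0 := free_torsion_free (lL0 0) (lL1 0) freeW.
have tf1 := free_torsion_free (lL1 0) (lL0 0) freePi.
have [e0 gen0] := even_part_cyclic modW freeW tf1.
have [e1 gen1] := even_part_cyclic modPi freePi tf0.
have e0N : e0 != 0.
  have [z] := odd_part_nonzero modPi freePi; apply: contraNneq => ez.
  by have [r ->] := gen0 z; rewrite ez (lin_0 (polyact_lin (lL0 0) r)).
have e1N : e1 != 0.
  have [z] := odd_part_nonzero modW freeW; apply: contraNneq => ez.
  by have [r ->] := gen1 z; rewrite ez (lin_0 (polyact_lin (lL1 0) r)).
have [p pE] := gen1 (G0 0 e0); have [q qE] := gen0 (G1 0 e1).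
(* Both p q and x describe G_0^2 e_0 = L_0 e_0, and e_0 is not torsion. *)
have pqX : p * q = 'X.
  have : polyact (L0 0) (p * q - 'X) e0 = 0.
    rewrite (lin_B (polyact_phi_lin (L0 0) e0)) (polyactM (lL0 0)) -qE.
    rewrite -(polyact_commute p e1 (lG1 0) (G_commutes modPi)) -pE (G_squared modW).
    by rewrite -[X in polyact _ X]mul1r (polyactMX (lL0 0)) polyact1 subrr.
  by case/tf0 => [/eqP|ez]; [rewrite subr_eq0 => /eqP | rewrite ez eqxx in e0N].
have pq0 : p * q != 0 by rewrite pqX polyX_eq0.
move: (pq0); rewrite mulf_eq0 negb_or => /andP [p0 q0].
have const_gen (r : {poly CC}) : r != 0 -> (size r <= 1)%N -> exists2 c, c != 0 & r = c%:P.
  by move=> r0 /size1_polyC rE; exists r`_0 => //; rewrite -polyC_eq0 -rE.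
(* As deg p + deg q = 1, one factor is a nonzero constant. If it is [p], then G_0 e_0 generates the
   odd part; otherwise G_0 e_1 generates the even part and the parity change of W is used. *)
have [size_p|size_p] := leqP (size p) 1.
  have [c c0 pc] := const_gen p p0 size_p.
  have gen1' : generates (L1 0) (G0 0 e0).
    by rewrite pE pc polyactC; exact: generates_scale.
  have [mu [alpha [mu0 iso]]] := iso_of_generator modW tf0 tf1 e0N gen0 gen1'.
  exists (mu ^+ 2), alpha, mu; rewrite expf_neq0 //; do 2![split=> //].
  by exists 1; split; left.
have size_q : (size q <= 1)%N.
  have := congr1 (fun r : {poly CC} => size r) pqX; rewrite size_mul // size_polyX.
  by size_lia.
have [c c0 qc] := const_gen q q0 size_q.
have gen0' : generates (L0 0) (G1 0 e1).
  by rewrite qE qc polyactC; exact: generates_scale.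
have [mu [alpha [mu0 iso]]] := iso_of_generator modPi tf1 tf0 e1N gen1 gen0'.
exists (mu ^+ 2), alpha, mu; rewrite expf_neq0 //; do 2![split=> //].
by exists 1; split; [left | right].
Qed.
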